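(* Let $\Phi$ be a frame for $\mathcal H$ with lower frame bound $m_\Phi$ and let the Bessel sequence $\Psi$ be a $\mu$-perturbation of $\Phi$ with $\mu<\sqrt{m_\Phi}$. Then $\Psi$ is a frame for $\mathcal H$ with lower frame bound $(\sqrt{m_\Phi}-\mu)^2$. Moreover, if $\mathcal A_1,\mathcal A_2\in B(\mathcal H)$ satisfy $\|Id_{\mathcal H}-\mathcal A_i\|_{\rm op}<1$ ($i=1,2$), then for the canonical approximate duals $\Phi^{ad}_0(\mathcal A_1)$ and $\Psi^{ad}_0(\mathcal A_2)$ of $\Phi$ and $\Psi$, respectively, we have \begin{align*} \big\|\Phi^{ad}_0(\mathcal A_1)-\Psi^{ad}_0(\mathcal A_2)\big\|_{\mathfrak{Fr}}&\le\frac{2\mu\|\mathcal A_1\|_{\rm op}}{\sqrt{m_\Phi}(\sqrt{m_\Phi}-\mu)}+\frac{\|\mathcal A_1-\mathcal A_2\|_{\rm op}}{\sqrt{m_\Phi}-\mu}\\ &\le\frac{2\mu}{\sqrt{m_\Phi}(\sqrt{m_\Phi}-\mu)}+\frac{\varepsilon_1(2\mu+\sqrt{m_\Phi})}{\sqrt{m_\Phi}(\sqrt{m_\Phi}-\mu)}+\frac{\varepsilon_2}{\sqrt{m_\Phi}-\mu}, \end{align*} where $\varepsilon_1$ and $\varepsilon_2$ are the approximation rates of $\big(\Phi,\Phi^{ad}_0(\mathcal A_1)\big)$ and $\big(\Psi,\Psi^{ad}_0(\mathcal A_2)\big)$, respectively.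
   Context: $\mathcal H$ is a separable Hilbert space, $\ell^2=\ell^2(\mathbb N)$. A sequence $\Phi=(\varphi_n)_{n\in\mathbb N}$ in $\mathcal H$ is a frame with (lower, upper) bounds $m_\Phi,M_\Phi>0$ if $m_\Phi\|f\|^2\le\sum_n|\langle f,\varphi_n\rangle|^2\le M_\Phi\|f\|^2$ for all $f\in\mathcal H$; it is a Bessel sequence if the right inequality holds. For a Bessel sequence $\Phi$: the analysis operator is $U_\Phi:\mathcal H\to\ell^2$, $U_\Phi f=(\langle f,\varphi_n\rangle)_n$; the synthesis operator is $T_\Phi=U_\Phi^*$; the frame operator is $S_\Phi=T_\Phi U_\Phi$; and $\|\Phi\|_{\mathfrak{Fr}}:=\|T_\Phi\|_{\rm op}$. Differences of sequences are componentwise. A Bessel sequence $\Psi$ is a $\mu$-perturbation of $\Phi$ if $\|\Phi-\Psi\|_{\mathfrak{Fr}}=\|T_\Phi-T_\Psi\|_{\rm op}\le\mu$. For a frame $\Phi$ and $\mathcal A\in B(\mathcal H)$ with $\|Id_{\mathcal H}-\mathcal A\|_{\rm op}<1$, the canonical approximate dual $\Phi^{ad}_0(\mathcal A)$ is the sequence $\big(\mathcal A^*S_\Phi^{-1}\varphi_n\big)_n$; it satisfies $T_\Phi U_{\Phi^{ad}_0(\mathcal A)}=\mathcal A$. The approximation rate of a pair $(\Phi,\Phi^{ad})$ with $\|Id_{\mathcal H}-T_\Phi U_{\Phi^{ad}}\|_{\rm op}<1$ is a number $\varepsilon\in[0,1)$ with $\|Id_{\mathcal H}-T_\Phi U_{\Phi^{ad}}\|_{\rm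 op}\le\varepsilon$. *)

(* Defs.v *)
From HB Require Import structures.
From mathcomp Require Import all_boot all_order all_algebra.
From mathcomp Require Import sesquilinear complex.
From mathcomp Require Import all_classical all_reals all_analysis.

Set Implicit Arguments.
Unset Strict Implicit.
Unset Printing Implicit Defensive.

Import Order.TTheory GRing.Theory Num.Theory.
Import numFieldNormedType.Exports.

Local Open Scope classical_set_scope.
Local Open Scope ring_scope.

(* Hilbert spaces are taken over either the real or the complex numbers. *)
Inductive scalar_kind := RealScalars | ComplexScalars.

Definition scalar_field (R : realType) (s : scalar_kind) : numFieldType :=
  match s with RealScalars => R | ComplexScalars => R[i] end.

Definition sconj (R : realType) (s : scalar_kind) :
    {rmorphism scalar_field R s -> scalar_field R s} :=
  match s return {rmorphism scalar_field R s -> scalar_field R s} with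
  | RealScalars => idfun
  | ComplexScalars => @conjc R
  end.
Arguments sconj {R s}.

Definition sre (R : realType) (s : scalar_kind) : scalar_field R s -> R :=
  match s return scalar_field R s -> R with
  | RealScalars => idfun
  | ComplexScalars => @complex.Re R
  end.
Arguments sre {R s}.

(* The norm `|x| of a normed module over K takes its values in K; [nrm x] is
   the same number as an element of R. *)
Definition nrm (R : realType) (s : scalar_kind)
  (V : normedModType (scalar_field R s)) (x : V) : R := sre `|x|.

(* Operator norm of A on the unit ball of the domain D; it is +oo when A is
   unbounded. *)
Definition opnorm_on (R : realType) (X Y : Type) (D : set X)
    (nX : X -> R) (nY : Y -> R) (A : X -> Y) : \bar R :=
  ereal_sup [set (nY (A x))%:E | x in [set x | D x /\ nX x <= 1]].

Definition opnorm (R : realType) (s : scalar_kind)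
  (V W : normedModType (scalar_field R s)) (A : V -> W) : \bar R :=
  opnorm_on setT (@nrm R s V) (@nrm R s W) A.

(* [adjoint dV dW A w] is the v such that <A x, w> = <x, v> for all x (unique
   when dV is definite); the value 0 is used if there is no such v. *)
Definition adjoint (K : numFieldType) (V : lmodType K) (W : Type)
    (dV : V -> V -> K) (dW : W -> W -> K) (A : V -> W) (w : W) : V :=
  xget 0 [set v | forall x, dW (A x) w = dV x v].

Section ell2.
Context {R : realType} {s : scalar_kind}.
Local Notation K := (scalar_field R s).

Definition l2sq (c : nat -> K) : \bar R :=
  (\sum_(0 <= n <oo) (sre `|c n| ^+ 2)%:E)%E.

Definition l2 : set (nat -> K) := [set c | (l2sq c < +oo)%E].

Definition l2norm (c : nat -> K) : R := Num.sqrt (fine (l2sq c)).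

Definition l2dot (a b : nat -> K) : K :=
  limn (series (fun n => a n * sconj (b n))).

End ell2.

Section frames.
Context {R : realType} {s : scalar_kind} {H : completeNormedModType (scalar_field R s)}.
Variable dot : {dot H for @sconj R s}.
Implicit Types (Phi Psi : nat -> H) (A : H -> H).

Definition analysis Phi (f : H) : nat -> scalar_field R s := fun n => dot f (Phi n).

Definition bessel Phi : Prop :=
  exists2 M : R, 0 < M &
    forall f : H, (l2sq (analysis Phi f) <= (M * nrm f ^+ 2)%:E)%E.

Definition frame_with_bounds (m M : R) Phi : Prop :=
  [/\ 0 < m, 0 < M &
    forall f : H, ((m * nrm f ^+ 2)%:E <= l2sq (analysis Phi f))%E /\
                  (l2sq (analysis Phi f) <= (M * nrm f ^+ 2)%:E)%E].

Definition frame_with_lower_bound (m : R) Phi : Prop :=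
  exists M : R, frame_with_bounds m M Phi.

Definition synthesis Phi : (nat -> scalar_field R s) -> H :=
  adjoint dot l2dot (analysis Phi).

Definition frame_op Phi : H -> H := synthesis Phi \o analysis Phi.

(* The synthesis operator exists as an operator on l^2 only for Bessel
   sequences, hence the value +oo for all other sequences. *)
Definition frnorm Phi : \bar R :=
  if `[< bessel Phi >] then
    opnorm_on l2 l2norm (@nrm R s H) (synthesis Phi)
  else +oo%E.

Definition perturbation (mu : R) Phi Psi : Prop :=
  bessel Psi /\ (frnorm (fun n => Phi n - Psi n)%R <= mu%:E)%E.

Definition canonical_approx_dual A Phi : nat -> H :=
  fun n => adjoint dot dot A ('pinv_(fun=> 0) [set: H] (frame_op Phi) (Phi n)).

Definition approximation_rate (eps : R) Phi Phiad : Prop :=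
  0 <= eps < 1 /\
  (opnorm (fun f : H => f - (synthesis Phi \o analysis Phiad) f)%R <= eps%:E)%E.

End frames.

(* Main.v *)
Require Import Defs.
From HB Require Import structures.
From mathcomp Require Import all_boot all_order all_algebra.
From mathcomp Require Import sesquilinear complex.
From mathcomp Require Import all_classical all_reals all_analysis.
From mathcomp Require Import ring lra.

Set Implicit Arguments.
Unset Strict Implicit.
Unset Printing Implicit Defensive.

Import Order.TTheory GRing.Theory Num.Theory.
Import numFieldNormedType.Exports.

Local Open Scope classical_set_scope.
Local Open Scope ring_scope.

(** Write U_Phi for the analysis operator and S for the frame operator of Phi.
    Moving A^* and S^{-1} to the other side of the inner product shows that the
    canonical approximate dual has analysis operator U_Phi S^{-1} A
    ([analysis_canonical]), and the norm of a synthesis operator is the least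
    constant bounding the analysis operator ([frnorm_le], [le_frnorm]). So
    everything reduces to estimating, with x = S_Phi^{-1} g and
    y = S_Psi^{-1} g, the sequence d = U_Phi x - U_Psi y in l^2.

    Let U_Psi z be the orthogonal projection of d on the range of U_Psi and
    D = U_Phi - U_Psi, so |D h| <= mu |h|. Since d differs from D x by an
    element of the range of U_Psi, |d - U_Psi z| <= |D x| <= (mu / m) |g|. Since
    U_Phi^* U_Phi x = g = U_Psi^* U_Psi y, one has
    |U_Psi z|^2 = <d, U_Psi z> = - <U_Phi x, D z>, which bounds |U_Psi z| by
    mu |g| / (sqrt m (sqrt m - mu)) ([pseudo_inverse_perturbation]). The sum is
    at most 2 mu |g| / (sqrt m (sqrt m - mu)). The remaining term
    U_Psi S_Psi^{-1} (A1 - A2) has norm at most |A1 - A2| / (sqrt m - mu) by the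
    lower frame bound of Psi, and that bound is the triangle inequality in l^2.
    The second estimate follows from T_Phi U_{Phi_ad} = A
    ([synthesis_canonical]).

    The adjoints, the inverse frame operator and the projection all come from
    one representation theorem, [coercive_riesz]: a bounded linear functional is
    represented by any bounded coercive hermitian form on a complete space. It
    is used with the inner product and with <U_Phi x, U_Phi y>. Likewise,
    Cauchy-Schwarz is proved once for semi-inner products ([semi_inner]) and
    used in H, in l^2 and for this form. *)

(** * Real and complex scalars *)

Section Scalars.
Context {R : realType} {s : scalar_kind}.
Local Notation K := (scalar_field R s).
Implicit Types (x y z : K) (r t : R).

(** The embedding of the real numbers in the scalar field. *)
Definition ofreal : R -> K :=
  match s return R -> scalar_field R s with
  | RealScalars => idfun
  | ComplexScalars => real_complex R
  end.

Lemma ofrealD : {morph ofreal : r t / r + t}.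
Proof. by rewrite /ofreal; case: s => //= r t; rewrite rmorphD. Qed.

Lemma ofreal0 : ofreal 0 = 0.
Proof. by rewrite /ofreal; case: s. Qed.

Lemma ofreal1 : ofreal 1 = 1.
Proof. by rewrite /ofreal; case: s. Qed.

Lemma ofrealN : {morph ofreal : r / - r}.
Proof.
move=> r; apply/esym/eqP.
by rewrite -subr_eq0 -opprD -ofrealD subrr ofreal0 oppr0.
Qed.

Lemma sre_ofreal r : sre (ofreal r) = r.
Proof. by rewrite /ofreal /sre; case: s. Qed.

Lemma sreD : {morph @sre R s : x y / x + y}.
Proof. by rewrite /sre; case: s => //= -[a b] [c d]. Qed.

Lemma sre0 : sre (0 : K) = 0.
Proof. by rewrite -ofreal0 sre_ofreal. Qed.

Lemma sreN : {morph @sre R s : x / - x}.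
Proof.
move=> x; apply/esym/eqP.
by rewrite -subr_eq0 -opprD -sreD subrr sre0 oppr0.
Qed.

Lemma sreB : {morph @sre R s : x y / x - y}.
Proof. by move=> x y; rewrite sreD sreN. Qed.

Lemma sreMl r x : sre (ofreal r * x) = r * sre x.
Proof.
rewrite /ofreal /sre; case: s x => //= -[a b] /=.
by rewrite mul0r subr0.
Qed.

Lemma sre_sconj x : sre (sconj x) = sre x.
Proof. by rewrite /sre /sconj; case: s x => //= -[a b]. Qed.

Lemma sconjK : involutive (@sconj R s).
Proof. by rewrite /sconj; case: s => //= x; exact: conjcK. Qed.

Lemma ofreal_ge0 r : (0 <= ofreal r) = (0 <= r).
Proof. by rewrite /ofreal; case: s => //=; rewrite ler0c. Qed.

Lemma ofreal_lt r t : (ofreal r < ofreal t) = (r < t).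
Proof. by rewrite /ofreal; case: s => //=; rewrite ltcR. Qed.

Lemma ofreal_sre x : 0 <= x -> ofreal (sre x) = x.
Proof.
rewrite /ofreal /sre; case: s x => //= x x0.
by rewrite RRe_real// ger0_real.
Qed.

Lemma sre_ge0 x : 0 <= x -> 0 <= sre x.
Proof. by move=> x0; rewrite -ofreal_ge0 ofreal_sre. Qed.

Lemma sreXn x n : 0 <= x -> sre (x ^+ n) = sre x ^+ n.
Proof.
move=> x0; elim: n => [|n IH]; first by rewrite !expr0 -ofreal1 sre_ofreal.
by rewrite !exprS -IH -{1}(ofreal_sre x0) sreMl.
Qed.

Lemma mul_sconj x : x * sconj x = `|x| ^+ 2.
Proof.
rewrite /sconj; case: s x => //= x; first by rewrite real_normK ?num_real.
by rewrite sqr_normc.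
Qed.

Lemma norm_sconj x : `|sconj x| = `|x|.
Proof.
apply/eqP; rewrite -(@eqrXn2 _ 2)// -!mul_sconj sconjK mulrC //.
Qed.

Lemma norm_ofreal r : `|ofreal r| = ofreal `|r|.
Proof.
rewrite /ofreal; case: s => //=; apply: etrans (normc_def _) _.
by rewrite /= expr0n/= addr0 sqrtr_sqr.
Qed.

Lemma ler_sre_norm x : `|sre x| <= sre `|x|.
Proof.
rewrite /sre; case: s x => /= x; first exact: lexx.
suff : `|complex.Re x| <= complex.Re `|(x : R[i])| by [].
by rewrite normc_def /= -sqrtr_sqr ler_wsqrtr// lerDl sqr_ge0.
Qed.

Lemma sre_le x y : x <= y -> sre x <= sre y.
Proof. by rewrite -subr_ge0 => /sre_ge0; rewrite sreB subr_ge0. Qed.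

Lemma sre_norm_ge0 x : 0 <= sre `|x|.
Proof. exact/sre_ge0. Qed.

Lemma sreM_sconj x : sre (x * sconj x) = sre `|x| ^+ 2.
Proof. by rewrite mul_sconj sreXn. Qed.

Lemma ler_sre_mul x y :
  sre `|x * sconj y| <= (sre `|x| ^+ 2 + sre `|y| ^+ 2) / 2.
Proof.
rewrite normrM norm_sconj -(ofreal_sre (normr_ge0 x)) sreMl !sre_ofreal.
set a := sre _; set b := sre _; have := sqr_ge0 (a - b); lra.
Qed.

Lemma sre_cvg (u : nat -> K) (l : K) : u @ \oo --> l ->
  (fun n => sre (u n)) @ \oo --> sre l.
Proof.
move=> ul; apply/cvgrPdist_lt => e e0.
have e0' : 0 < ofreal e by rewrite -ofreal0 ofreal_lt.
move/cvgrPdist_lt: ul => /(_ _ e0'); apply: filterS => n.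
rewrite -(ofreal_sre (normr_ge0 _)) ofreal_lt; apply: le_lt_trans.
by rewrite -sreB ler_sre_norm.
Qed.

Lemma ofreal_cvg (u : nat -> R) (l : R) : u @ \oo --> l ->
  (fun n => ofreal (u n)) @ \oo --> ofreal l.
Proof.
move=> ul; apply/cvgrPdist_lt => e e0.
have e0' : 0 < sre e by rewrite -(@ofreal_lt 0) ofreal0 ofreal_sre// ltW.
move/cvgrPdist_lt: ul => /(_ _ e0'); apply: filterS => n.
by rewrite -ofreal_lt ofreal_sre ?ltW// -ofrealN -ofrealD norm_ofreal.
Qed.

Lemma sconj_cvg (u : nat -> K) (l : K) : u @ \oo --> l ->
  (fun n => sconj (u n)) @ \oo --> sconj l.
Proof.
move=> ul; apply/cvgrPdist_lt => e e0.
move/cvgrPdist_lt: ul => /(_ _ e0); apply: filterS => n.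
by rewrite -rmorphB norm_sconj.
Qed.

End Scalars.
Arguments ofreal {R s}.

(** The multipliers 1 and -i give the real and the imaginary parts. *)
Lemma is_cvg_sre (R : realType) (s : scalar_kind)
    (u : nat -> scalar_field R s) :
  (forall k, cvgn (fun n => sre (k * u n))) -> cvgn u.
Proof.
case: s u => u h.
  by have := h 1; under eq_fun do rewrite mul1r.
pose z : scalar_field R ComplexScalars := ('i%C : R[i]).
have /cvg_ex[a ha] := h 1; have /cvg_ex[b hb] := h (- z).
apply/cvg_ex; exists (ofreal a + z * ofreal b).
have -> : u = (fun n => ofreal (sre (1 * u n)) + z * ofreal (sre (- z * u n))).
  apply/funext => n; rewrite mul1r; case: (u n) => c d.
  by apply/eqP; rewrite eq_complex /=; simpc.
apply: cvgD; first exact: ofreal_cvg ha.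
by apply: cvgMl_tmp; exact: ofreal_cvg hb.
Qed.

(** * Real-valued norms and completeness *)

Section RealNorm.
Context {R : realType} {s : scalar_kind} {V : normedModType (scalar_field R s)}.
Implicit Types (x y : V).

Lemma nrm_ge0 x : 0 <= nrm x.
Proof. exact/sre_ge0. Qed.

Lemma nrm0 : nrm (0 : V) = 0.
Proof. by rewrite /nrm normr0 sre0. Qed.

Lemma nrmE x : `|x| = ofreal (nrm x).
Proof. by rewrite /nrm ofreal_sre. Qed.

Lemma nrm_eq0 x : (nrm x == 0) = (x == 0).
Proof.
apply/eqP/eqP => [x0|->]; last exact: nrm0.
by apply/eqP; rewrite -normr_eq0 nrmE x0 ofreal0.
Qed.

Lemma ler_nrmD x y : nrm (x + y) <= nrm x + nrm y.
Proof. by rewrite /nrm -sreD; apply: sre_le; exact: ler_normD. Qed.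

Lemma nrmN x : nrm (- x) = nrm x.
Proof. by rewrite /nrm normrN. Qed.

Lemma nrmZ (a : scalar_field R s) x : nrm (a *: x) = sre `|a| * nrm x.
Proof. by rewrite /nrm normrZ -{1}(ofreal_sre (normr_ge0 a)) sreMl. Qed.

Lemma nrmZr (r : R) x : 0 <= r -> nrm (ofreal r *: x) = r * nrm x.
Proof. by move=> r0; rewrite nrmZ norm_ofreal ger0_norm// sre_ofreal. Qed.

End RealNorm.

(** Completeness of H in terms of the real-valued norm. *)
Lemma nrm_complete (R : realType) (s : scalar_kind)
    (H : completeNormedModType (scalar_field R s)) (u : nat -> H) :
  (forall e : R, 0 < e -> exists N, forall i j, (N <= i)%N -> (N <= j)%N ->
     nrm (u i - u j) < e) ->
  exists v, forall e : R, 0 < e -> exists N, forall n, (N <= n)%N ->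
     nrm (v - u n) < e.
Proof.
move=> uC.
have ofreal_e e : 0 < e -> 0 < sre e /\ ofreal (sre e) = e :> scalar_field R s.
  move=> e0; have ee : ofreal (sre e) = e by rewrite ofreal_sre ?ltW.
  by split=> //; rewrite -(@ofreal_lt _ s 0) ofreal0 ee.
have : cvgn u.
  apply/cauchy_cvgP/cauchy_ballP => e /ofreal_e[e0 <-].
  have [N hN] := uC _ e0; near_simpl.
  exists ([set i | (N <= i)%N], [set i | (N <= i)%N]).
    by split; exact: nbhs_infty_ge.
  move=> [i j] /= [Ni Nj]; rewrite -ball_normE /= nrmE ofreal_lt.
  exact: hN.
move=> /cvg_ex[v /cvgrPdist_lt uv]; exists v => e e0.
have e0' : 0 < ofreal e :> scalar_field R s by rewrite -ofreal0 ofreal_lt.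
have [N _ hN] := uv _ e0'; exists N => n Nn.
by rewrite -(@ofreal_lt _ s) -nrmE; exact: hN.
Qed.

(** * Semi-inner products *)

(** The discriminant inequality; the degenerate case [c = 0] is included. *)
Lemma quadratic_ge0 (R : realFieldType) (a b c : R) :
  0 <= c -> (forall t, 0 <= a + 2 * t * b + t ^+ 2 * c) -> b ^+ 2 <= a * c.
Proof.
rewrite le_eqVlt => /predU1P[<-|c0] h.
  rewrite mulr0; case: (eqVneq b 0) => [->|b0]; first by rewrite expr0n.
  have := h (- (a + 1) / (2 * b)).
  have -> : a + 2 * (- (a + 1) / (2 * b)) * b + (- (a + 1) / (2 * b)) ^+ 2 * 0
     = -1 by field.
  by rewrite oppr_ge0 ler10.
have := h (- b / c).
have -> : a + 2 * (- b / c) * b + (- b / c) ^+ 2 * c = (a * c - b ^+ 2) / c.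
  by field; rewrite gt_eqF.
by rewrite pmulr_lge0 ?invr_gt0// subr_ge0.
Qed.

Section SemiInner.
Context {R : realType} {s : scalar_kind} {V : lmodType (scalar_field R s)}.
Local Notation K := (scalar_field R s).

(** Positive semidefinite hermitian sesquilinear forms, linear in the first
    argument. They are only required to behave well on a subspace [D], because
    [l2dot] is meaningful only on [l2] inside the space of all sequences. *)
Record semi_inner (D : set V) (g : V -> V -> K) : Prop := SemiInner {
  semi_inner_closed : forall (a : K) x y, D x -> D y -> D (a *: x + y);
  semi_inner_linear : forall (a : K) x y z, D x -> D y -> D z ->
    g (a *: x + y) z = a * g x z + g y z;
  semi_inner_herm : forall x y, D x -> D y -> g x y = sconj (g y x);
  semi_inner_ge0 : forall x, D x -> 0 <= sre (g x x)
}.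

Variables (D : set V) (g : V -> V -> K).
Hypothesis gP : semi_inner D g.

(** The seminorm attached to [g]; it is used on [D] only. *)
Definition seminorm (x : V) : R := Num.sqrt (sre (g x x)).
Local Notation gn := seminorm.

Lemma semi_innerD_in x y : D x -> D y -> D (x + y).
Proof. by move=> Dx Dy; rewrite -[x]scale1r; exact: (semi_inner_closed gP). Qed.

Lemma semi_inner0_in x : D x -> D 0.
Proof.
by move=> Dx; rewrite -(addNr x) -scaleN1r; exact: (semi_inner_closed gP).
Qed.

Lemma semi_innerZ_in (a : K) x : D x -> D (a *: x).
Proof.
move=> Dx; rewrite -[_ *: _]addr0.
by apply: (semi_inner_closed gP) => //; exact: semi_inner0_in Dx.
Qed.

Lemma semi_innerN_in x : D x -> D (- x).
Proof. by rewrite -scaleN1r; exact: semi_innerZ_in. Qed.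

Lemma semi_innerB_in x y : D x -> D y -> D (x - y).
Proof. by move=> Dx Dy; apply: semi_innerD_in => //; exact: semi_innerN_in. Qed.

Lemma semi_innerDl x y z : D x -> D y -> D z -> g (x + y) z = g x z + g y z.
Proof.
by move=> Dx Dy Dz; rewrite -[x in LHS]scale1r (semi_inner_linear gP)// mul1r.
Qed.

Lemma semi_innerZl (a : K) x z : D x -> D z -> g (a *: x) z = a * g x z.
Proof.
move=> Dx Dz; have D0 := semi_inner0_in Dx.
have g0 : g 0 z = 0.
  by apply: (addrI (g 0 z)); rewrite -semi_innerDl// !addr0.
by rewrite -[_ *: _]addr0 (semi_inner_linear gP)// g0 addr0.
Qed.

Lemma semi_innerNl x z : D x -> D z -> g (- x) z = - g x z.
Proof. by move=> Dx Dz; rewrite -scaleN1r semi_innerZl// mulN1r. Qed.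

Lemma semi_innerBl x y z : D x -> D y -> D z -> g (x - y) z = g x z - g y z.
Proof.
by move=> Dx Dy Dz; rewrite semi_innerDl ?semi_innerNl//; exact: semi_innerN_in.
Qed.

Lemma semi_innerBr x y z : D x -> D y -> D z -> g z (x - y) = g z x - g z y.
Proof.
move=> Dx Dy Dz; rewrite (semi_inner_herm gP)//; last exact: semi_innerB_in.
by rewrite semi_innerBl// rmorphB/= -!(semi_inner_herm gP).
Qed.

Lemma sre_semi_innerC x y : D x -> D y -> sre (g x y) = sre (g y x).
Proof. by move=> Dx Dy; rewrite (semi_inner_herm gP)// sre_sconj. Qed.

Lemma semi_inner_quadratic x y t : D x -> D y ->
  sre (g (x + ofreal t *: y) (x + ofreal t *: y)) =
  sre (g x x) + 2 * t * sre (g x y) + t ^+ 2 * sre (g y y).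
Proof.
move=> Dx Dy; have Dty := semi_innerZ_in (ofreal t) Dy.
have Dxy := semi_innerD_in Dx Dty.
rewrite semi_innerDl// sreD (sre_semi_innerC Dx)// (sre_semi_innerC Dty)//.
rewrite !semi_innerDl// !sreD (sre_semi_innerC Dx Dty) !semi_innerZl// !sreMl.
rewrite (sre_semi_innerC Dy Dty) semi_innerZl// sreMl (sre_semi_innerC Dx Dy).
by ring.
Qed.

Lemma sqr_seminorm x : D x -> gn x ^+ 2 = sre (g x x).
Proof. by move=> Dx; rewrite sqr_sqrtr//; exact: (semi_inner_ge0 gP). Qed.

Lemma seminorm_ge0 x : 0 <= gn x.
Proof. exact: sqrtr_ge0. Qed.

Lemma seminormN x : D x -> gn (- x) = gn x.
Proof.
move=> Dx; have DNx := semi_innerN_in Dx.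
rewrite /seminorm semi_innerNl// sreN (sre_semi_innerC Dx DNx).
by rewrite semi_innerNl// sreN opprK.
Qed.

Lemma semi_inner_CS x y : D x -> D y -> `|sre (g x y)| <= gn x * gn y.
Proof.
move=> Dx Dy; rewrite /seminorm -sqrtrM ?(semi_inner_ge0 gP)// -sqrtr_sqr.
apply: ler_wsqrtr; apply: quadratic_ge0 => [|t].
  exact: (semi_inner_ge0 gP).
rewrite -semi_inner_quadratic//; apply: (semi_inner_ge0 gP).
by apply: semi_innerD_in => //; exact: semi_innerZ_in.
Qed.

Lemma semi_inner_le x y : D x -> D y -> sre (g x y) <= gn x * gn y.
Proof.
by move=> Dx Dy; apply: le_trans (semi_inner_CS Dx Dy); exact: ler_norm.
Qed.

Lemma ler_seminormD x y : D x -> D y -> gn (x + y) <= gn x + gn y.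
Proof.
move=> Dx Dy; have gx := seminorm_ge0 x; have gy := seminorm_ge0 y.
rewrite -(@ler_pXn2r _ 2) ?nnegrE ?addr_ge0 ?seminorm_ge0//.
rewrite sqr_seminorm; last exact: semi_innerD_in.
have := semi_inner_quadratic 1 Dx Dy; rewrite ofreal1 scale1r => ->.
have := semi_inner_le Dx Dy; rewrite -!sqr_seminorm//; nra.
Qed.

End SemiInner.

(** * Riesz representation for coercive forms *)

Section Riesz.
Context {R : realType} {s : scalar_kind}.
Local Notation K := (scalar_field R s).
Variables (H : completeNormedModType K) (g : H -> H -> K) (m M : R).
Hypotheses (gP : semi_inner setT g) (m0 : 0 < m).
Hypothesis g_ge : forall x, m * nrm x ^+ 2 <= sre (g x x).
Hypothesis g_le : forall x, sre (g x x) <= M * nrm x ^+ 2.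

(** The functional J x = g(x,x) - 2 Re f(x) is bounded below. A point [u] with
    [J u < inf J + d ^+ 2] almost satisfies the first-order condition
    g(u,x) = f(x) up to an error [d * seminorm g x]; hence a minimizing sequence
    is Cauchy and its limit represents Re f, which determines f. *)
Lemma coercive_riesz (f : H -> K) (C : R) :
  (forall (a : K) x y, f (a *: x + y) = a * f x + f y) ->
  (forall x, `|sre (f x)| <= C * nrm x) ->
  exists v, forall x, f x = g x v.
Proof.
move=> fL fC.
have fD x y : sre (f (x + y)) = sre (f x) + sre (f y).
  by rewrite -[x in LHS]scale1r fL mul1r sreD.
have f0 : f 0 = 0.
  have := fL 1 0 0; rewrite scaler0 addr0 mul1r -[LHS]addr0.
  by move=> /addrI.
have fZ a x : f (a *: x) = a * f x by rewrite -[_ *: _]addr0 fL f0 addr0.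
pose J x := sre (g x x) - 2 * sre (f x).
have J_ge x : - (C ^+ 2 / m) <= J x.
  have /andP[_ h] : - (C * nrm x) <= sre (f x) <= C * nrm x.
    by rewrite -ler_norml.
  apply: (@le_trans _ _ (m * nrm x ^+ 2 - 2 * (C * nrm x))); last first.
    by rewrite /J; have := g_ge x; lra.
  rewrite -subr_ge0.
  (* completing the square *)
  have -> : m * nrm x ^+ 2 - 2 * (C * nrm x) - - (C ^+ 2 / m) =
    (m * nrm x - C) ^+ 2 / m by field; rewrite gt_eqF.
  by rewrite divr_ge0 ?sqr_ge0// ltW.
have infJ : has_inf [set J x | x in setT].
  split; first by exists (J 0), 0.
  by exists (- (C ^+ 2 / m)) => _ [x _ <-].
pose j := inf [set J x | x in setT].
have j_le x : j <= J x by apply: ge_inf; [case: infJ|exists x].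
pose d n : R := n.+1%:R^-1.
have d0 n : 0 < d n by rewrite invr_gt0.
have /choice[u hu] : forall n, exists x, J x < j + d n ^+ 2.
  move=> n; have [_ [x _ <-] h] := inf_adherent (exprn_gt0 2 (d0 n)) infJ.
  by exists x.
have first_order n x : `|sre (g (u n) x) - sre (f x)| <= d n * seminorm g x.
  have -> : d n = Num.sqrt (d n ^+ 2) by rewrite sqrtr_sqr gtr0_norm.
  rewrite /seminorm -sqrtrM ?sqr_ge0//.
  rewrite -sqrtr_sqr; apply: ler_wsqrtr; apply: quadratic_ge0 => [|t].
    exact: semi_inner_ge0 gP _ _.
  have := j_le (u n + ofreal t *: x); rewrite /J.
  rewrite (semi_inner_quadratic gP)// fD fZ sreMl => h1.
  by have := hu n; rewrite /J; lra.
have sn_ge x : Num.sqrt m * nrm x <= seminorm g x.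
  have -> : nrm x = Num.sqrt (nrm x ^+ 2).
    by rewrite sqrtr_sqr ger0_norm ?nrm_ge0.
  by rewrite -sqrtrM ?(ltW m0)//; exact: ler_wsqrtr.
have sm0 : 0 < Num.sqrt m by rewrite sqrtr_gt0.
have u_cauchy i k : nrm (u i - u k) <= (d i + d k) / Num.sqrt m.
  rewrite ler_pdivlMr// mulrC; apply: le_trans (sn_ge _) _.
  set x := u i - u k.
  have [->|x0] := eqVneq (seminorm g x) 0; first by rewrite addr_ge0// ltW.
  have {}x0 : 0 < seminorm g x by rewrite lt_neqAle eq_sym x0 seminorm_ge0.
  rewrite -(ler_pM2r x0) -expr2 (sqr_seminorm gP)//.
  rewrite {1}/x (semi_innerBl gP)// sreB mulrDl.
  move: (first_order i x) (first_order k x); rewrite !ler_norml; lra.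
have d_small e : 0 < e -> exists N, forall n, (N <= n)%N -> d n < e.
  move=> e0; exists (Num.truncn e^-1) => n Nn.
  rewrite /d invf_plt ?posrE//; apply: lt_le_trans (truncnS_gt _) _.
  by rewrite ler_nat.
have [|v hv] := @nrm_complete R s H u.
  move=> e e0; have [|N hN] := d_small (e * Num.sqrt m / 2).
    by rewrite divr_gt0// mulr_gt0.
  exists N => i k Ni Nk; apply: le_lt_trans (u_cauchy i k) _.
  by rewrite ltr_pdivrMr//; have := hN _ Ni; have := hN _ Nk; lra.
exists v => x.
have sn_le y : seminorm g y <= Num.sqrt `|M| * nrm y.
  have -> : nrm y = Num.sqrt (nrm y ^+ 2).
    by rewrite sqrtr_sqr ger0_norm ?nrm_ge0.
  rewrite -sqrtrM//; apply: ler_wsqrtr; apply: le_trans (g_le y) _.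
  by rewrite ler_wpM2r ?sqr_ge0// ler_norm.
have re_eq y : sre (f y) = sre (g y v).
  apply/eqP; rewrite -subr_eq0 -normr_eq0 eq_le normr_ge0 andbT.
  apply/ler_addgt0Pr => e e0; rewrite add0r.
  set A := seminorm g y; set B := Num.sqrt `|M|.
  have A0 : 0 <= A by exact: seminorm_ge0.
  have B0 : 0 <= B by exact: sqrtr_ge0.
  pose e' := e / ((B + 1) * (A + 1)).
  have e'0 : 0 < e' by rewrite divr_gt0// mulr_gt0// ltr_wpDl.
  have [N1 h1] := hv _ e'0; have [N2 h2] := d_small _ e'0.
  pose n := maxn N1 N2.
  have {}h1 := h1 n (leq_maxl _ _); have {}h2 := h2 n (leq_maxr _ _).
  have h3 := first_order n y.
  have h4 := semi_inner_CS gP (I : setT (v - u n)) (I : setT y).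
  have {h4} : `|sre (g (v - u n) y)| <= B * e' * A.
    apply: le_trans h4 _; rewrite ler_wpM2r//.
    by apply: le_trans (sn_le _) _; rewrite ler_wpM2l// ltW.
  have {h3} : `|sre (g (u n) y) - sre (f y)| <= e' * A.
    by apply: le_trans h3 _; rewrite ler_wpM2r// ltW.
  rewrite (semi_innerBl gP)// sreB (sre_semi_innerC gP (I : setT y))//.
  have -> : e = e' * (B + 1) * (A + 1).
    rewrite /e'; field.
    by rewrite !gt_eqF ?ltr_wpDl.
  rewrite !ler_norml => /andP[a1 a2] /andP[a3 a4]; nra.
(* From real parts to scalars: test at the multiple of x by the conjugate of the
   defect k, where the difference of the two sides is `|k| ^+ 2. *)
apply/eqP; rewrite -subr_eq0; set k := f x - g x v.
have := re_eq (sconj k *: x).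
rewrite fZ (semi_innerZl gP)// => /eqP; rewrite -subr_eq0 -sreB -mulrBr -/k.
rewrite mulrC sreM_sconj expf_eq0 /= => k0.
by rewrite -normr_eq0 -(ofreal_sre (normr_ge0 k)) (eqP k0) ofreal0.
Qed.

End Riesz.

(** * The inner product of l^2 *)

Lemma is_cvg_series_lincomb (R : realType) (p q : R) (u v : nat -> R) :
  cvgn (series u) -> cvgn (series v) ->
  cvgn (series (fun n => p * u n + q * v n)).
Proof.
move=> cu cv.
have -> : (fun n => p * u n + q * v n) = p *: u + q *: v by [].
by apply: is_cvg_seriesD; exact: is_cvg_seriesZ.
Qed.

Section SquareSummable.
Context {R : realType} {s : scalar_kind}.
Local Notation K := (scalar_field R s).
Implicit Types (a b c : nat -> K).

Lemma l2_cvg c : l2 c -> cvgn (series (fun n => sre `|c n| ^+ 2)).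
Proof.
by move=> c2; apply: nnseries_is_cvg => // n; exact: sqr_ge0.
Qed.

Lemma l2sqE c : cvgn (series (fun n => sre `|c n| ^+ 2)) ->
  l2sq c = (limn (series (fun n => sre `|c n| ^+ 2)))%:E.
Proof.
move=> cc; rewrite /l2sq -EFin_lim//; congr (limn _).
by apply/funext => n; rewrite /= sumEFin.
Qed.

Lemma cvg_l2 c : cvgn (series (fun n => sre `|c n| ^+ 2)) -> l2 c.
Proof. by move=> cc; rewrite /l2/= l2sqE// ltry. Qed.

Lemma l2_closed (k : K) a b : l2 a -> l2 b -> l2 (k *: a + b).
Proof.
move=> /l2_cvg a2 /l2_cvg b2; apply: cvg_l2.
apply: (@series_le_cvg _ _
    (fun n => 2 * sre `|k| ^+ 2 * sre `|a n| ^+ 2 + 2 * sre `|b n| ^+ 2)).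
- by move=> n; exact: sqr_ge0.
- by move=> n; rewrite addr_ge0// mulr_ge0 ?sqr_ge0// mulr_ge0 ?sqr_ge0.
- move=> n; apply: (@le_trans _ _ ((sre `|k| * sre `|a n| + sre `|b n|) ^+ 2)).
    rewrite ler_pXn2r ?nnegrE ?addr_ge0 ?mulr_ge0 ?sre_norm_ge0//.
    have -> : sre `|k| * sre `|a n| = sre `|k * a n|.
      by rewrite normrM -{2}(ofreal_sre (normr_ge0 k)) sreMl.
    by rewrite -sreD; apply: sre_le; exact: ler_normD.
  have := sqr_ge0 (sre `|k| * sre `|a n| - sre `|b n|); lra.
- exact: is_cvg_series_lincomb a2 b2.
Qed.

Lemma sre_sum (n : nat) (u : nat -> K) :
  sre (\sum_(0 <= i < n) u i) = \sum_(0 <= i < n) sre (u i).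
Proof. exact: (big_morph _ (@sreD R s) sre0). Qed.

(** Absolute convergence, since 2 |a_n b_n| <= |a_n|^2 + |b_n|^2. *)
Lemma l2dot_cvg a b : l2 a -> l2 b ->
  cvgn (series (fun n => a n * sconj (b n))).
Proof.
move=> /l2_cvg a2 /l2_cvg b2; apply: is_cvg_sre => k.
have -> : (fun n => sre (k * series (fun n => a n * sconj (b n)) n)) =
    series (fun n => sre (k * (a n * sconj (b n)))).
  by apply/funext => n; rewrite /series/= mulr_sumr sre_sum.
apply: normed_cvg.
apply: (@series_le_cvg _ _ (fun n =>
  sre `|k| / 2 * sre `|a n| ^+ 2 + sre `|k| / 2 * sre `|b n| ^+ 2)).
- by move=> n; exact: normr_ge0.
- by move=> n; rewrite addr_ge0// mulr_ge0 ?sqr_ge0// divr_ge0// sre_norm_ge0.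
- move=> n; apply: le_trans (ler_sre_norm _) _.
  rewrite normrM -(ofreal_sre (normr_ge0 k)) sreMl sre_ofreal.
  have := ler_sre_mul (a n) (b n).
  by move=> /(ler_wpM2l (sre_norm_ge0 k)); lra.
- exact: is_cvg_series_lincomb a2 b2.
Qed.

Lemma sre_l2dot c : l2 c ->
  sre (l2dot c c) = limn (series (fun n => sre `|c n| ^+ 2)).
Proof.
move=> c2; apply/esym/cvg_lim => //.
have := sre_cvg (l2dot_cvg c2 c2); apply: cvg_trans.
suff -> : (fun n => sre (series (fun n => c n * sconj (c n)) n)) =
  series (fun n => sre `|c n| ^+ 2) by [].
apply/funext => n; rewrite /series/= sre_sum.
by apply: eq_bigr => i _; rewrite sreM_sconj.
Qed.

Lemma l2sq_dot c : l2 c -> l2sq c = (sre (l2dot c c))%:E.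
Proof. by move=> c2; rewrite sre_l2dot// l2sqE//; exact: l2_cvg. Qed.

Lemma semi_inner_l2 : semi_inner (@l2 R s) l2dot.
Proof.
split.
- exact: l2_closed.
- move=> k a b c a2 b2 c2.
  have ac := l2dot_cvg a2 c2; have bc := l2dot_cvg b2 c2.
  apply/cvg_lim => //.
  have -> : series (fun n => (k *: a + b) n * sconj (c n)) =
      (fun n => k * series (fun n => a n * sconj (c n)) n +
                series (fun n => b n * sconj (c n)) n).
    apply/funext => n; rewrite /series /= mulr_sumr -big_split /=.
    by apply: eq_bigr => i _; rewrite mulrA -mulrDl.
  by apply: cvgD bc; exact: cvgMl_tmp ac.
- move=> a b a2 b2; apply/cvg_lim => //.
  have := sconj_cvg (l2dot_cvg b2 a2); apply: cvg_trans.
  suff -> : (fun n => sconj (series (fun n => b n * sconj (a n)) n)) =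
    series (fun n => a n * sconj (b n)) by [].
  apply/funext => n; rewrite /series/= rmorph_sum.
  by apply: eq_bigr => i _; rewrite rmorphM/= sconjK mulrC.
- move=> c c2; rewrite sre_l2dot//; apply: limr_ge; first exact: l2_cvg.
  by apply: nearW => n; apply: sumr_ge0 => i _; exact: sqr_ge0.
Qed.

Lemma l2norm_seminorm c : l2 c -> l2norm c = seminorm l2dot c.
Proof. by move=> c2; rewrite /l2norm l2sq_dot. Qed.

End SquareSummable.

(** * Operator norms *)

Section OperatorNorm.
Context {R : realType} {s : scalar_kind}.
Variables (V W : normedModType (scalar_field R s)) (A : V -> W).

Lemma opnorm_ge0 : A 0 = 0 -> (0 <= opnorm A)%E.
Proof.
move=> A0; apply: ereal_sup_ubound; exists 0; first by split; rewrite ?nrm0.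
by rewrite A0 nrm0.
Qed.

Lemma opnorm_le (C : R) : 0 <= C -> (forall x, nrm (A x) <= C * nrm x) ->
  (opnorm A <= C%:E)%E.
Proof.
move=> C0 h; apply: ge_ereal_sup => _ [x [_ x1] <-]; rewrite lee_fin.
by apply: le_trans (h x) _; rewrite ler_piMr.
Qed.

Lemma le_opnorm (C : R) : (forall a x, A (a *: x) = a *: A x) ->
  (opnorm A <= C%:E)%E -> forall x, nrm (A x) <= C * nrm x.
Proof.
move=> AZ A_le x; have [->|x0] := eqVneq x 0.
  by rewrite -(scale0r 0) AZ !scale0r !nrm0 mulr0.
have {}x0 : 0 < nrm x by rewrite lt_neqAle nrm_ge0 eq_sym nrm_eq0 x0.
have i0 : 0 <= (nrm x)^-1 by rewrite invr_ge0 ltW.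
rewrite -ler_pdivrMr// mulrC -(nrmZr _ i0) -AZ.
rewrite -lee_fin; apply: le_trans A_le; apply: ereal_sup_ubound.
exists (ofreal (nrm x)^-1 *: x) => //.
by split=> //; rewrite (nrmZr _ i0) mulVf ?gt_eqF.
Qed.

Lemma opnorm_fin (C : R) : A 0 = 0 -> (opnorm A <= C%:E)%E ->
  exists2 a : R, 0 <= a & opnorm A = a%:E.
Proof.
move=> A0 A_le; have Age0 := opnorm_ge0 A0.
exists (fine (opnorm A)); first exact: fine_ge0.
by rewrite fineK// ge0_fin_numE//; apply: le_lt_trans A_le (ltry _).
Qed.

End OperatorNorm.

(** * Bessel sequences and frames *)

Section Frames.
Context {R : realType} {s : scalar_kind}.
Local Notation K := (scalar_field R s).
Variables (H : completeNormedModType K) (dot : {dot H for @sconj R s}).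
Hypothesis dot_norm : forall x : H, dot x x = `|x| ^+ 2.
Implicit Types (Phi Psi : nat -> H).

Local Notation nl2 := (seminorm (@l2dot R s)).
Local Notation U := (analysis dot).
Local Notation l2I := (@semi_inner_l2 R s).

Lemma sre_dot_norm x : sre (dot x x) = nrm x ^+ 2.
Proof. by rewrite dot_norm sreXn. Qed.

Lemma dot_linear a x y z : dot (a *: x + y) z = a * dot x z + dot y z.
Proof. by rewrite linearDl linearZl_LR. Qed.

Lemma dot_sconj x y : dot x y = sconj (dot y x).
Proof. by rewrite (hermC dot x y)/= mul1r. Qed.

Lemma semi_inner_dot : semi_inner setT dot.
Proof.
split=> //.
- by move=> a x y z _ _ _; exact: dot_linear.
- by move=> x y _ _; exact: dot_sconj.
- by move=> x _; rewrite sre_dot_norm sqr_ge0.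
Qed.

Lemma seminorm_dot x : seminorm dot x = nrm x.
Proof. by rewrite /seminorm sre_dot_norm sqrtr_sqr ger0_norm// nrm_ge0. Qed.

Lemma dot_CS x y : `|sre (dot x y)| <= nrm x * nrm y.
Proof.
by rewrite -!seminorm_dot; exact: semi_inner_CS semi_inner_dot _ _ _ _.
Qed.

Lemma dotBr x y z : dot z (x - y) = dot z x - dot z y.
Proof. exact: (semi_innerBr semi_inner_dot). Qed.

Lemma dot_injr x y : (forall z, dot z x = dot z y) -> x = y.
Proof.
move=> h; apply/eqP; rewrite -subr_eq0 -nrm_eq0 -sqrf_eq0.
by rewrite -sre_dot_norm dotBr h subrr sre0.
Qed.

(** If a vector with the property defining the adjoint exists, then [adjoint]
    has this property. *)
Lemma adjointP (W : Type) (dW : W -> W -> K) (A : H -> W) (w : W) :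
  (exists v, forall x, dW (A x) w = dot x v) ->
  forall x, dW (A x) w = dot x (adjoint dot dW A w).
Proof. by case=> v hv; rewrite /adjoint; case: xgetP => // /(_ v). Qed.

Lemma riesz (f : H -> K) (C : R) :
  (forall (a : K) x y, f (a *: x + y) = a * f x + f y) ->
  (forall x, `|sre (f x)| <= C * nrm x) ->
  exists v, forall x, f x = dot x v.
Proof.
by apply: (coercive_riesz semi_inner_dot ltr01 (M := 1)) => x;
  rewrite mul1r sre_dot_norm.
Qed.

Lemma adjoint_bounded (A : {linear H -> H}) (C : R) (w : H) :
  (forall x, nrm (A x) <= C * nrm x) ->
  forall x, dot (A x) w = dot x (adjoint dot dot A w).
Proof.
move=> A_le; apply: adjointP.
apply: (@riesz (fun x => dot (A x) w) (C * nrm w)) => [a x y|x].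
  by rewrite linearP dot_linear.
apply: le_trans (dot_CS _ _) _.
by rewrite mulrAC ler_wpM2r ?nrm_ge0.
Qed.

Lemma analysis_linear Phi a x y : U Phi (a *: x + y) = a *: U Phi x + U Phi y.
Proof. by apply/funext => n; exact: dot_linear. Qed.

Lemma analysisB Phi x y : U Phi (x - y) = U Phi x - U Phi y.
Proof.
by rewrite addrC -scaleN1r analysis_linear scaleN1r addrC.
Qed.

Lemma analysis_subr Phi Psi x :
  U (fun n => Phi n - Psi n) x = U Phi x - U Psi x.
Proof. by apply/funext => n; exact: dotBr. Qed.

Lemma analysisE Phi x : l2 (U Phi x) ->
  l2sq (U Phi x) = (nl2 (U Phi x) ^+ 2)%:E.
Proof. by move=> x2; rewrite l2sq_dot// (sqr_seminorm l2I). Qed.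

Lemma analysis_l2 Phi : bessel dot Phi -> forall x, l2 (U Phi x).
Proof. by case=> M _ h x; apply: le_lt_trans (h x) (ltry _). Qed.

Lemma sqrtrM_sqr (c t : R) : 0 <= c -> 0 <= t ->
  Num.sqrt (c * t ^+ 2) = Num.sqrt c * t.
Proof. by move=> c0 t0; rewrite sqrtrM// sqrtr_sqr ger0_norm. Qed.

Lemma bessel_ler Phi : bessel dot Phi ->
  exists2 C : R, 0 < C & forall x, nl2 (U Phi x) <= C * nrm x.
Proof.
move=> bP; have [M M0 h] := bP; exists (Num.sqrt M); first by rewrite sqrtr_gt0.
move=> x; have := h x; rewrite analysisE ?lee_fin; last exact: analysis_l2.
move=> /ler_wsqrtr; rewrite (sqrtrM_sqr (ltW M0) (nrm_ge0 x)).
by rewrite sqrtr_sqr ger0_norm// seminorm_ge0.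
Qed.

Lemma ler_bessel Phi (C : R) : (forall x, l2 (U Phi x)) ->
  (forall x, nl2 (U Phi x) <= C * nrm x) -> bessel dot Phi.
Proof.
move=> P2 h; exists (C ^+ 2 + 1) => [|x]; first by rewrite ltr_wpDl ?sqr_ge0.
rewrite analysisE// lee_fin.
have x0 := le_trans (seminorm_ge0 _ _) (h x).
apply: (@le_trans _ _ ((C * nrm x) ^+ 2)).
  by rewrite ler_pXn2r ?nnegrE ?seminorm_ge0.
by rewrite exprMn ler_wpM2r ?sqr_ge0// lerDl.
Qed.

Lemma synthesisP Phi c : bessel dot Phi -> l2 c ->
  forall x, l2dot (U Phi x) c = dot x (synthesis dot Phi c).
Proof.
move=> bP c2; have P2 := analysis_l2 bP; apply: adjointP.
have [C _ hC] := bessel_ler bP.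
apply: (@riesz (fun x => l2dot (U Phi x) c) (C * nl2 c)) => [a x y|x].
  by rewrite analysis_linear (semi_inner_linear l2I).
apply: le_trans (semi_inner_CS l2I _ _) _ => //.
by rewrite mulrAC ler_wpM2r ?seminorm_ge0.
Qed.

(** A bound of the analysis operator bounds the synthesis operator: if y = T c,
    then |y|^2 = Re <U y, c> <= |U y| |c|. *)
Lemma frnorm_le Phi (C : R) : 0 <= C -> (forall x, l2 (U Phi x)) ->
  (forall x, nl2 (U Phi x) <= C * nrm x) -> (frnorm dot Phi <= C%:E)%E.
Proof.
move=> C0 P2 h; have bP := ler_bessel P2 h.
rewrite /frnorm; case: asboolP => // _.
apply: ge_ereal_sup => _ [c [c2 c1] <-]; rewrite lee_fin.
rewrite l2norm_seminorm// in c1; set y := synthesis _ _ _.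
have [->|y0] := eqVneq (nrm y) 0; first by [].
have {}y0 : 0 < nrm y by rewrite lt_neqAle nrm_ge0 eq_sym y0.
rewrite -(ler_pM2r y0) -expr2 -sre_dot_norm -synthesisP//.
apply: le_trans (semi_inner_le l2I _ _) _ => //.
apply: (@le_trans _ _ (nl2 (U Phi y))); last exact: h.
by rewrite ler_piMr ?seminorm_ge0.
Qed.

(** Conversely, pairing U x with the normalized sequence U x / |U x| gives
    |U x| <= |x| |T|. *)
Lemma le_frnorm Phi (C : R) : (frnorm dot Phi <= C%:E)%E ->
  0 <= C /\ forall x, l2 (U Phi x) /\ nl2 (U Phi x) <= C * nrm x.
Proof.
rewrite /frnorm; case: asboolP => [bP|_]; last by rewrite leye_eq.
move=> hC; have P2 := analysis_l2 bP.
have T_le c : l2 c -> nl2 c <= 1 -> nrm (synthesis dot Phi c) <= C.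
  move=> c2 c1; rewrite -lee_fin; apply: le_trans hC.
  apply: ereal_sup_ubound; exists c => //.
  by split=> //=; rewrite l2norm_seminorm.
have C0 : 0 <= C.
  have z2 : l2 (0 : nat -> K) := semi_inner0_in l2I (P2 0).
  apply: le_trans (T_le 0 z2 _); first exact: nrm_ge0.
  have -> : (0 : nat -> K) = 0 *: U Phi 0 by rewrite scale0r.
  have Z2 : l2 (0 *: U Phi 0) by exact: (semi_innerZ_in l2I).
  rewrite /seminorm (semi_innerZl l2I)// mul0r sre0 sqrtr0.
  exact: ler01.
split=> // x; split=> //.
have [->|n0] := eqVneq (nl2 (U Phi x)) 0; first by rewrite mulr_ge0 ?nrm_ge0.
have {}n0 : 0 < nl2 (U Phi x) by rewrite lt_neqAle eq_sym n0 seminorm_ge0.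
set t := nl2 _ in n0 *.
pose c := ofreal t^-1 *: U Phi x.
have c2 : l2 c by exact: (semi_innerZ_in l2I).
have sq : sre (l2dot (U Phi x) (U Phi x)) = t ^+ 2.
  by rewrite (sqr_seminorm l2I).
have xc : sre (l2dot (U Phi x) c) = t.
  rewrite (sre_semi_innerC l2I)// (semi_innerZl l2I)// sreMl sq.
  by rewrite expr2 mulKf// gt_eqF.
have c1 : nl2 c <= 1.
  rewrite /seminorm /c (semi_innerZl l2I)// sreMl xc mulVf ?gt_eqF//.
  by rewrite sqrtr1.
rewrite -[leLHS]xc synthesisP//; apply: le_trans (ler_norm _) _.
apply: le_trans (dot_CS _ _) _; rewrite mulrC ler_wpM2r ?nrm_ge0//.
exact: T_le.
Qed.

Lemma frame_bessel m Phi : frame_with_lower_bound dot m Phi -> bessel dot Phi.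
Proof. by case=> M [_ M0 h]; exists M => // x; case: (h x). Qed.

Lemma frame_ge m Phi : frame_with_lower_bound dot m Phi ->
  0 < m /\ forall x, Num.sqrt m * nrm x <= nl2 (U Phi x).
Proof.
move=> fP; have bP := frame_bessel fP; case: fP => M [m0 M0 h]; split=> // x.
have [+ _] := h x; rewrite analysisE ?lee_fin; last exact: analysis_l2.
move=> /ler_wsqrtr; rewrite (sqrtrM_sqr (ltW m0) (nrm_ge0 x)).
by rewrite sqrtr_sqr ger0_norm// seminorm_ge0.
Qed.

Lemma ge_frame (c : R) Phi : 0 < c -> bessel dot Phi ->
  (forall x, c * nrm x <= nl2 (U Phi x)) ->
  frame_with_lower_bound dot (c ^+ 2) Phi.
Proof.
move=> c0 bP h; have [M M0 hM] := bP; exists M; split=> // [|x].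
  exact: exprn_gt0.
split=> //; rewrite analysisE ?lee_fin; last exact: analysis_l2.
rewrite -exprMn ler_pXn2r ?nnegrE ?seminorm_ge0//.
by rewrite mulr_ge0 ?nrm_ge0// ltW.
Qed.

(** * The frame operator and canonical approximate duals *)

Section FrameOperator.
Variables (Phi : nat -> H) (m : R).
Hypothesis frame_Phi : frame_with_lower_bound dot m Phi.
Let bP := frame_bessel frame_Phi.
Let P2 := analysis_l2 bP.
Let m0 := (frame_ge frame_Phi).1.
Local Notation S := (frame_op dot Phi).

Lemma dot_frame_op x y : dot x (S y) = l2dot (U Phi x) (U Phi y).
Proof. by rewrite /frame_op /= synthesisP. Qed.

Lemma frame_form : semi_inner setT (fun x y => l2dot (U Phi x) (U Phi y)).
Proof.
split=> //.
- by move=> a x y z _ _ _; rewrite analysis_linear (semi_inner_linear l2I).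
- by move=> x y _ _; exact: (semi_inner_herm l2I).
- by move=> x _; exact: (semi_inner_ge0 l2I).
Qed.

(** The form <U x, U y> is bounded and coercive by the frame inequalities. *)
Lemma frame_riesz (f : H -> K) (C : R) :
  (forall (a : K) x y, f (a *: x + y) = a * f x + f y) ->
  (forall x, `|sre (f x)| <= C * nrm x) ->
  exists v, forall x, f x = l2dot (U Phi x) (U Phi v).
Proof.
have [C' C'0 hC'] := bessel_ler bP.
apply: (coercive_riesz frame_form m0 (M := C' ^+ 2)) => x;
  rewrite -(sqr_seminorm l2I)//.
  have [_ /(_ x)] := frame_ge frame_Phi.
  rewrite -(@ler_pXn2r _ 2) ?nnegrE ?seminorm_ge0//; last first.
    by rewrite mulr_ge0 ?sqrtr_ge0 ?nrm_ge0.
  by rewrite exprMn sqr_sqrtr// ltW.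
by rewrite -exprMn ler_pXn2r ?nnegrE ?seminorm_ge0 ?mulr_ge0 ?nrm_ge0// ltW.
Qed.

(** The inverse of the frame operator. For a frame it is a two-sided inverse by
    [frame_opK] and [frame_op_inj], so the default value 0 of the partial
    inverse is never taken. *)
Definition frame_inv : H -> H := 'pinv_(fun=> 0) [set: H] S.

Lemma frame_opK h : S (frame_inv h) = h.
Proof.
have [v hv] : exists v, forall x, dot x h = l2dot (U Phi x) (U Phi v).
  apply: (@frame_riesz (fun x => dot x h) (nrm h)) => [a x y|x].
    exact: dot_linear.
  by rewrite mulrC; exact: dot_CS.
apply: pinvK; rewrite inE; exists v => //; apply: dot_injr => x.
by rewrite dot_frame_op hv.
Qed.

Lemma frame_opB x y : S (x - y) = S x - S y.
Proof.
apply: dot_injr => z; rewrite dotBr !dot_frame_op analysisB.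
exact: (semi_innerBr l2I).
Qed.

Lemma frame_op_inj : injective S.
Proof.
move=> x y Sxy; apply/eqP; rewrite -subr_eq0 -nrm_eq0.
have [_ /(_ (x - y))] := frame_ge frame_Phi.
have -> : nl2 (U Phi (x - y)) = 0.
  apply/eqP; rewrite -sqrf_eq0 (sqr_seminorm l2I)// -dot_frame_op.
  by rewrite frame_opB Sxy subrr -(subrr x) dotBr subrr sre0.
rewrite pmulr_rle0 ?sqrtr_gt0// => h.
by rewrite eq_le h nrm_ge0.
Qed.

Lemma frame_invB g h : frame_inv (g - h) = frame_inv g - frame_inv h.
Proof. by apply: frame_op_inj; rewrite frame_opB !frame_opK. Qed.

(** With x = S^{-1} g: |U x|^2 = <x, g> <= |x| |g| and
    sqrt m |x| <= |U x| give both bounds. *)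
Lemma frame_inv_ler g :
  nl2 (U Phi (frame_inv g)) <= nrm g / Num.sqrt m /\
  nrm (frame_inv g) <= nrm g / m.
Proof.
have [_ /(_ (frame_inv g)) h] := frame_ge frame_Phi.
set x := frame_inv g in h *; set t := nl2 _ in h *.
have sm0 : 0 < Num.sqrt m by rewrite sqrtr_gt0.
have t_le : t <= nrm g / Num.sqrt m.
  have [->|t0] := eqVneq t 0; first by rewrite divr_ge0 ?nrm_ge0 ?sqrtr_ge0.
  have {}t0 : 0 < t by rewrite lt_neqAle eq_sym t0 seminorm_ge0.
  rewrite ler_pdivlMr// -(ler_pM2r t0) mulrAC -expr2 (sqr_seminorm l2I)//.
  rewrite -dot_frame_op frame_opK.
  have := le_trans (ler_norm _) (dot_CS x g).
  move=> /(ler_wpM2r (sqrtr_ge0 m)) /le_trans; apply.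
  rewrite mulrAC [leLHS]mulrC ler_wpM2l ?nrm_ge0//.
  by rewrite mulrC.
split=> //.
have -> : nrm g / m = nrm g / Num.sqrt m / Num.sqrt m.
  by rewrite -{1}[m]sqr_sqrtr ?ltW// expr2 invfM mulrA.
by rewrite ler_pdivlMr//; apply: le_trans t_le; rewrite mulrC.
Qed.

(** <f, A^* S^{-1} phi_n> = <A f, S^{-1} phi_n> = <S^{-1} A f, phi_n>, as S is
    self-adjoint. *)
Lemma analysis_canonical (A : {linear H -> H}) (C : R) f :
  (forall x, nrm (A x) <= C * nrm x) ->
  U (canonical_approx_dual dot A Phi) f = U Phi (frame_inv (A f)).
Proof.
move=> A_le; apply/funext => n; rewrite /analysis /canonical_approx_dual.
rewrite -/frame_inv -(adjoint_bounded _ A_le).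
rewrite -{1}[A f]frame_opK dot_sconj dot_frame_op.
by rewrite -(semi_inner_herm l2I)// -dot_frame_op frame_opK.
Qed.

(** The canonical approximate dual satisfies T_Phi U_{Phi_ad} = A. *)
Lemma synthesis_canonical (A : {linear H -> H}) (C : R) f :
  (forall x, nrm (A x) <= C * nrm x) ->
  synthesis dot Phi (U (canonical_approx_dual dot A Phi) f) = A f.
Proof.
by move=> A_le; rewrite (analysis_canonical _ A_le); exact: frame_opK.
Qed.

End FrameOperator.

End Frames.

(** * Perturbation of frames *)

Section Perturbation.
Context {R : realType} {s : scalar_kind}.
Local Notation K := (scalar_field R s).
Variables (H : completeNormedModType K) (dot : {dot H for @sconj R s}).
Hypothesis dot_norm : forall x : H, dot x x = `|x| ^+ 2.
Variables (Phi Psi : nat -> H) (m p mu : R).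
Hypotheses (frame_Phi : frame_with_lower_bound dot m Phi)
  (frame_Psi : frame_with_lower_bound dot p Psi).
Local Notation nl2 := (seminorm (@l2dot R s)).
Local Notation U := (analysis dot).
Local Notation l2I := (@semi_inner_l2 R s).
Hypothesis mu0 : 0 <= mu.
Hypothesis U_close : forall x, nl2 (U Phi x - U Psi x) <= mu * nrm x.

(** U S^{-1} is the adjoint of the pseudo-inverse S^{-1} T of U, so this bounds
    the difference of the pseudo-inverses of U_Phi and U_Psi. *)
Lemma pseudo_inverse_perturbation g :
  nl2 (U Phi (frame_inv dot Phi g) - U Psi (frame_inv dot Psi g)) <=
  (mu / m + mu / (Num.sqrt m * Num.sqrt p)) * nrm g.
Proof.
have Phi2 := analysis_l2 (frame_bessel frame_Phi).
have Psi2 := analysis_l2 (frame_bessel frame_Psi).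
have [m0 _] := frame_ge frame_Phi.
have [p0 Psi_ge] := frame_ge frame_Psi.
have sm0 : 0 < Num.sqrt m by rewrite sqrtr_gt0.
have sp0 : 0 < Num.sqrt p by rewrite sqrtr_gt0.
set x := frame_inv dot Phi g; set y := frame_inv dot Psi g.
set d := U Phi x - U Psi y.
have d2 : l2 d by exact: (semi_innerB_in l2I).
have [Ux_le x_le] := frame_inv_ler dot_norm frame_Phi g.
(* U Psi z is the orthogonal projection of d on the range of U Psi. *)
have [z hz] : exists z, forall h, l2dot (U Psi h) d = l2dot (U Psi h) (U Psi z).
  have [C C0 hC] := bessel_ler (frame_bessel frame_Psi).
  apply: (frame_riesz frame_Psi (f := fun h => l2dot (U Psi h) d)
    (C := C * nl2 d)) => [a u v|u].
    by rewrite analysis_linear (semi_inner_linear l2I).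
  apply: le_trans (semi_inner_CS l2I (Psi2 u) d2) _.
  by rewrite mulrAC ler_wpM2r ?seminorm_ge0.
pose q := d - U Psi z.
have q2 : l2 q by exact: (semi_innerB_in l2I).
pose D h := U Phi h - U Psi h.
have D2 h : l2 (D h) by exact: (semi_innerB_in l2I).
have q_orth h : sre (l2dot (U Psi h) q) = 0.
  by rewrite (semi_innerBr l2I d2 (Psi2 z) (Psi2 h)) hz subrr sre0.
(* The part of d orthogonal to the range: d = D x + U Psi (x - y). *)
have q_le : nl2 q <= mu / m * nrm g.
  apply: (@le_trans _ _ (mu * nrm x)); last first.
    by rewrite -mulrA; apply: ler_wpM2l => //; rewrite mulrC.
  have [->|q0] := eqVneq (nl2 q) 0; first by rewrite mulr_ge0 ?nrm_ge0.
  have {}q0 : 0 < nl2 q by rewrite lt_neqAle eq_sym q0 seminorm_ge0.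
  rewrite -(ler_pM2r q0) -expr2 (sqr_seminorm l2I q2).
  have -> : sre (l2dot q q) = sre (l2dot (D x) q).
    have -> : l2dot q q = l2dot (D x + U Psi (x - y - z)) q.
      by congr (l2dot _ _); rewrite !analysisB /q /d /D !addrA subrK.
    by rewrite (semi_innerDl l2I (D2 x) (Psi2 _) q2) sreD q_orth addr0.
  apply: le_trans (semi_inner_le l2I (D2 x) q2) _.
  by rewrite ler_pM2r//; exact: U_close.
(* The part of d in the range: <U Phi x, U Phi z> = <g, z> = <U Psi y, U Psi z>,
   so <d, U Psi z> = - <U Phi x, D z>. *)
have z_le : nl2 (U Psi z) <= mu / (Num.sqrt m * Num.sqrt p) * nrm g.
  have [->|z0] := eqVneq (nl2 (U Psi z)) 0.
    by rewrite !mulr_ge0 ?nrm_ge0// invr_ge0 mulr_ge0// ltW.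
  have {}z0 : 0 < nl2 (U Psi z) by rewrite lt_neqAle eq_sym z0 seminorm_ge0.
  rewrite -(ler_pM2r z0) -expr2 (sqr_seminorm l2I (Psi2 z)) -hz.
  rewrite (sre_semi_innerC l2I (Psi2 z) d2).
  have -> : sre (l2dot d (U Psi z)) = sre (l2dot (U Phi x) (- D z)).
    rewrite /D opprB (semi_innerBr l2I (Psi2 z) (Phi2 z) (Phi2 x)).
    rewrite (semi_innerBl l2I (Phi2 x) (Psi2 y) (Psi2 z)) !sreB.
    rewrite (sre_semi_innerC l2I (Psi2 y) (Psi2 z)).
    rewrite (sre_semi_innerC l2I (Phi2 x) (Phi2 z)).
    rewrite -(dot_frame_op dot_norm frame_Phi).
    rewrite -(dot_frame_op dot_norm frame_Psi).
    by rewrite (frame_opK dot_norm frame_Phi) (frame_opK dot_norm frame_Psi).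
  have ND2 : l2 (- D z) by exact: (semi_innerN_in l2I).
  apply: le_trans (semi_inner_le l2I (Phi2 x) ND2) _.
  rewrite (seminormN l2I (D2 z)).
  have Dz : nl2 (D z) <= mu * (nl2 (U Psi z) / Num.sqrt p).
    apply: le_trans (U_close z) _; apply: ler_wpM2l => //.
    by rewrite ler_pdivlMr// mulrC.
  have -> : mu / (Num.sqrt m * Num.sqrt p) * nrm g * nl2 (U Psi z) =
    nrm g / Num.sqrt m * (mu * (nl2 (U Psi z) / Num.sqrt p)).
    by field; rewrite !gt_eqF.
  by apply: ler_pM => //; exact: seminorm_ge0.
have -> : d = q + U Psi z by rewrite /q subrK.
apply: le_trans (ler_seminormD l2I q2 (Psi2 z)) _.
by rewrite mulrDl; exact: lerD.
Qed.

(** U_Theta f splits as the difference of the pseudo-inverses at A1 f, plus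
    U_Psi S_Psi^{-1} (A1 f - A2 f). *)
Lemma approx_dual_perturbation (A1 A2 : {linear H -> H}) (a1 a2 b : R) f :
  (forall x, nrm (A1 x) <= a1 * nrm x) ->
  (forall x, nrm (A2 x) <= a2 * nrm x) ->
  (forall x, nrm (A1 x - A2 x) <= b * nrm x) ->
  let Theta := fun n => canonical_approx_dual dot A1 Phi n -
                        canonical_approx_dual dot A2 Psi n in
  l2 (U Theta f) /\
  nl2 (U Theta f) <=
    ((mu / m + mu / (Num.sqrt m * Num.sqrt p)) * a1 + b / Num.sqrt p) * nrm f.
Proof.
move=> hA1 hA2 hb Theta.
have Phi2 := analysis_l2 (frame_bessel frame_Phi).
have Psi2 := analysis_l2 (frame_bessel frame_Psi).
have [m0 _] := frame_ge frame_Phi.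
have [p0 _] := frame_ge frame_Psi.
have -> : U Theta f =
  (U Phi (frame_inv dot Phi (A1 f)) - U Psi (frame_inv dot Psi (A1 f))) +
  U Psi (frame_inv dot Psi (A1 f - A2 f)).
  rewrite /Theta analysis_subr// (analysis_canonical dot_norm frame_Phi f hA1).
  rewrite (analysis_canonical dot_norm frame_Psi f hA2).
  by rewrite (frame_invB dot_norm frame_Psi) analysisB addrA subrK.
have l2B := semi_innerB_in l2I (Phi2 (frame_inv dot Phi (A1 f)))
  (Psi2 (frame_inv dot Psi (A1 f))).
split; first exact: (semi_innerD_in l2I).
apply: le_trans (ler_seminormD l2I l2B (Psi2 _)) _.
rewrite mulrDl; apply: lerD.
  apply: le_trans (pseudo_inverse_perturbation _) _.
  rewrite -mulrA; apply: ler_wpM2l => //.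
  by rewrite addr_ge0// divr_ge0 ?mulr_ge0 ?sqrtr_ge0// ltW.
apply: le_trans (proj1 (frame_inv_ler dot_norm frame_Psi _)) _.
by rewrite mulrAC; apply: ler_wpM2r; rewrite ?invr_ge0 ?sqrtr_ge0.
Qed.

End Perturbation.

Theorem proposition4p3 (R : realType) (s : scalar_kind)
    (H : completeNormedModType (scalar_field R s))
    (dot : {dot H for @sconj R s})
    (dot_norm : forall x : H, dot x x = `|x| ^+ 2)
    (separableH : exists2 D : set H, countable D & dense D)
    (Phi Psi : nat -> H) (m mu : R)
    (frame_Phi : frame_with_lower_bound dot m Phi)
    (pert_Psi : perturbation dot mu Phi Psi)
    (mu_lt : mu < Num.sqrt m) :
  frame_with_lower_bound dot ((Num.sqrt m - mu) ^+ 2) Psi /\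
  forall (A1 A2 : {linear H -> H})
    (bounded_A1 : bounded_near A1 (nbhs (0 : H)))
    (bounded_A2 : bounded_near A2 (nbhs (0 : H)))
    (near_id_A1 : (opnorm (fun f : H => f - A1 f)%R < 1)%E)
    (near_id_A2 : (opnorm (fun f : H => f - A2 f)%R < 1)%E),
  let Phi_ad := canonical_approx_dual dot A1 Phi in
  let Psi_ad := canonical_approx_dual dot A2 Psi in
  let bound :=
    ((2 * mu)%:E * opnorm A1 / (Num.sqrt m * (Num.sqrt m - mu))%:E +
     opnorm (fun f : H => A1 f - A2 f)%R / (Num.sqrt m - mu)%:E)%E in
  (frnorm dot (fun n => Phi_ad n - Psi_ad n)%R <= bound)%E /\
  forall (eps1 eps2 : R)
    (rate1 : approximation_rate dot eps1 Phi Phi_ad)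
    (rate2 : approximation_rate dot eps2 Psi Psi_ad),
  (bound <=
    (2 * mu / (Num.sqrt m * (Num.sqrt m - mu)) +
     eps1 * (2 * mu + Num.sqrt m) / (Num.sqrt m * (Num.sqrt m - mu)) +
     eps2 / (Num.sqrt m - mu))%:E)%E.

Proof.
have bPhi := frame_bessel frame_Phi.
have Phi2 := analysis_l2 bPhi.
have [m0 Phi_ge] := frame_ge frame_Phi.
have [bPsi frPsi] := pert_Psi.
have Psi2 := analysis_l2 bPsi.
have [mu0 U_diff] := le_frnorm dot_norm frPsi.
have U_close x : seminorm l2dot (analysis dot Phi x - analysis dot Psi x) <=
    mu * nrm x.
  by have [_] := U_diff x; rewrite (analysis_subr dot_norm).
set p := Num.sqrt m - mu.
have sm0 : 0 < Num.sqrt m by rewrite sqrtr_gt0.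
have p0 : 0 < p by rewrite subr_gt0.
have frame_Psi : frame_with_lower_bound dot (p ^+ 2) Psi.
  apply: ge_frame => // x.
  have D2 := semi_innerB_in semi_inner_l2 (Phi2 x) (Psi2 x).
  have := ler_seminormD semi_inner_l2 D2 (Psi2 x).
  rewrite subrK => h; rewrite mulrBl.
  by have := U_close x; have := Phi_ge x; lra.
split=> // A1 A2 _ _ near_id_A1 near_id_A2 Phi_ad Psi_ad bound.
(* ||I - B|| <= e controls I - B pointwise and gives ||B|| <= 1 + e. *)
have id_sub_le (B : {linear H -> H}) (e : R) :
    (opnorm (fun f => f - B f)%R <= e%:E)%E ->
    (forall x, nrm (x - B x) <= e * nrm x) /\
    (forall x, nrm (B x) <= (1 + e) * nrm x).
  move=> He.
  have h : forall x, nrm (x - B x) <= e * nrm x.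
    by apply: le_opnorm He => k x; rewrite (linearZZ B) -scalerBr.
  split=> // x; rewrite -[B x](subKr x) mulrDl mul1r.
  by apply: le_trans (ler_nrmD _ _) _; rewrite nrmN lerD2l.
have opnorm_sub_fin (B1 B2 : {linear H -> H}) (e1 e2 : R) :
    (opnorm (fun f => f - B1 f)%R <= e1%:E)%E ->
    (opnorm (fun f => f - B2 f)%R <= e2%:E)%E ->
    0 <= e1 -> 0 <= e2 ->
    (opnorm (fun f => B1 f - B2 f)%R <= (e1 + e2)%:E)%E.
  move=> /id_sub_le[h1 _] /id_sub_le[h2 _] e10 e20.
  apply: opnorm_le => [|x]; first exact: addr_ge0.
  have -> : B1 x - B2 x = (x - B2 x) - (x - B1 x).
    by rewrite opprB [RHS]addrC addrA subrK.
  apply: le_trans (ler_nrmD _ _) _; rewrite nrmN.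
  by have := h1 x; have := h2 x; lra.
have [_ A1_2] := id_sub_le _ _ (ltW near_id_A1).
have [_ A2_2] := id_sub_le _ _ (ltW near_id_A2).
have [a1 a10 A1E] : exists2 a : R, 0 <= a & opnorm A1 = a%:E.
  apply: (opnorm_fin (C := 1 + 1)); first exact: linear0.
  by apply: opnorm_le A1_2; rewrite addr_ge0.
have [b b0 BE] : exists2 b : R, 0 <= b &
    opnorm (fun f : H => A1 f - A2 f)%R = b%:E.
  apply: (opnorm_fin (C := 1 + 1)).
    by rewrite (linear0 A1) (linear0 A2) subrr.
  by apply: opnorm_sub_fin => //; exact: ltW.
have A1_le : forall x, nrm (A1 x) <= a1 * nrm x.
  by apply: le_opnorm; [exact: linearZZ|rewrite A1E].
have B_le : forall x, nrm (A1 x - A2 x) <= b * nrm x.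
  apply: (@le_opnorm _ _ _ _ (fun x => A1 x - A2 x)) => [k x|].
    by rewrite (linearZZ A1) (linearZZ A2) -scalerBr.
  by rewrite BE.
have boundE : bound = (2 * mu * a1 / (Num.sqrt m * p) + b / p)%:E.
  rewrite /bound A1E BE -/p !inver !gt_eqF// ?mulr_gt0//.
rewrite boundE; split.
  have sp : Num.sqrt (p ^+ 2) = p by rewrite sqrtr_sqr gtr0_norm.
  have Theta_le x := approx_dual_perturbation dot_norm frame_Phi frame_Psi
    mu0 U_close x A1_le A2_2 B_le.
  apply: (frnorm_le dot_norm) => [|x|x]; last 2 first.
  - by have [] := Theta_le x.
  - have [_] := Theta_le x => /le_trans; apply.
    apply: ler_wpM2r; first exact: nrm_ge0.
    rewrite sp lerD2r -[leRHS]mulrAC; apply: ler_wpM2r => //.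
    (* m >= sqrt m (sqrt m - mu) turns the two terms into the factor 2 mu. *)
    have mp : mu / m <= mu / (Num.sqrt m * p).
      rewrite ler_wpM2l// lef_pV2 ?posrE ?mulr_gt0//.
      by rewrite -[leRHS](sqr_sqrtr (ltW m0)) expr2 ler_pM2l// lerBlDr lerDl.
    by rewrite -mulrA; lra.
  by rewrite addr_ge0// divr_ge0 ?mulr_ge0 ?sqrtr_ge0// ltW.
move=> eps1 eps2 [/andP[e10 _] rate1] [/andP[e20 _] rate2].
have {}rate1 : (opnorm (fun f => f - A1 f)%R <= eps1%:E)%E.
  apply: le_trans rate1; rewrite le_eqVlt; apply/orP; left; apply/eqP.
  congr opnorm; apply/funext => f; congr (_ - _).
  by rewrite /= (synthesis_canonical dot_norm frame_Phi f A1_2).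
have {}rate2 : (opnorm (fun f => f - A2 f)%R <= eps2%:E)%E.
  apply: le_trans rate2; rewrite le_eqVlt; apply/orP; left; apply/eqP.
  congr opnorm; apply/funext => f; congr (_ - _).
  by rewrite /= (synthesis_canonical dot_norm frame_Psi f A2_2).
have a1_le : a1 <= 1 + eps1.
  rewrite -lee_fin -A1E; have [_] := id_sub_le _ _ rate1.
  by apply: opnorm_le; rewrite addr_ge0.
have b_le : b <= eps1 + eps2 by rewrite -lee_fin -BE; exact: opnorm_sub_fin.
rewrite lee_fin -/p.
have -> : 2 * mu / (Num.sqrt m * p) +
    eps1 * (2 * mu + Num.sqrt m) / (Num.sqrt m * p) + eps2 / p =
    2 * mu * (1 + eps1) / (Num.sqrt m * p) + (eps1 + eps2) / p.
  by field; rewrite !gt_eqF.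
apply: lerD; last by rewrite ler_pM2r ?invr_gt0.
rewrite ler_pM2r ?invr_gt0 ?mulr_gt0//.
by apply: ler_wpM2l => //; rewrite mulr_ge0.
Qed.
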